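(* Let $p$ and $r$ be prime numbers with $p \equiv 9 \pmod{16}$, $r \equiv 3 \pmod 4$, $\left(\frac{p}{r}\right) = -1$, and $\left(\frac{2}{p}\right)_4 = -1$. Let $\mathbb{Q}_n(\sqrt{p})$ be the $n$-th layer in the cyclotomic $\mathbb{Z}_2$-extension of $\mathbb{Q}(\sqrt{p})$. Then the 2-rank of the maximal abelian extension of $\mathbb{Q}_n(\sqrt{p})$ unramified outside the primes above 2 and $r$ is at least 2.
   Context: $\mathbb{Q}_n$ denotes the maximal real subfield of $\mathbb{Q}(\zeta_{2^{n+2}})$, the $n$-th layer of the cyclotomic $\mathbb{Z}_2$-extension of $\mathbb{Q}$. The 2-rank of an abelian extension means the 2-rank of its Galois group $G$, i.e. the dimension over $\mathbb{Z}/2\mathbb{Z}$ of $G/2G$. $\left(\frac{p}{r}\right)$ is the Legendre symbol, and $\left(\frac{2}{p}\right)_4 = -1$ means that 2 is not a fourth power modulo $p$. *)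

(* Defs.v *)
(* All number fields, and their possibly infinite algebraic extensions, are
   subfields of algC. *)
From HB Require Import structures.
From mathcomp Require Import all_boot all_order all_algebra all_field.
From mathcomp Require Import boolp.

Set Implicit Arguments.
Unset Strict Implicit.
Unset Printing Implicit Defensive.

Import Order.TTheory GRing.Theory Num.Theory.
Local Open Scope ring_scope.

Notation subfieldC := (divringClosed algC).

Record field_of (L : subfieldC) :=
  FieldOf { field_val :> algC; field_valP : field_val \in L }.
HB.instance Definition _ (L : subfieldC) := [isSub for @field_val L].
HB.instance Definition _ (L : subfieldC) := [Choice of field_of L by <:].
HB.instance Definition _ (L : subfieldC) :=
  [SubChoice_isSubIntegralDomain of field_of L by <:].
HB.instance Definition _ (L : subfieldC) :=
  [SubIntegralDomain_isSubField of field_of L by <:].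

Definition integral_in (L : subfieldC) : {pred algC} := [predI L & Aint].

Fact integral_in_subring (L : subfieldC) : subring_closed (integral_in L).
Proof.
split; first by rewrite inE !rpred1.
- move=> x y /andP[xL xA] /andP[yL yA].
  by apply/andP; split; apply: rpredB.
- move=> x y /andP[xL xA] /andP[yL yA].
  by apply/andP; split; apply: rpredM.
Qed.
HB.instance Definition _ (L : subfieldC) :=
  GRing.isSubringClosed.Build algC (integral_in L) (integral_in_subring L).

Record ringInt (L : subfieldC) :=
  RingInt { int_val :> algC; int_valP : int_val \in integral_in L }.
HB.instance Definition _ (L : subfieldC) := [isSub for @int_val L].
HB.instance Definition _ (L : subfieldC) := [Choice of ringInt L by <:].
HB.instance Definition _ (L : subfieldC) :=
  [SubChoice_isSubComRing of ringInt L by <:].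

Definition generated_pred (A : algC -> Prop) : {pred algC} :=
  fun x => `[< forall L : subfieldC, (forall a, A a -> a \in L) -> x \in L >].

Fact generated_divring (A : algC -> Prop) : divring_closed (generated_pred A).
Proof.
split; first by apply/asboolP => L _; apply: rpred1.
- move=> x y /asboolP xA /asboolP yA.
  by apply/asboolP => L AL; apply: rpredB; [apply: xA | apply: yA].
- move=> x y /asboolP xA /asboolP yA.
  by apply/asboolP => L AL; apply: rpred_div; [apply: xA | apply: yA].
Qed.
HB.instance Definition _ (A : algC -> Prop) :=
  GRing.isDivringClosed.Build algC (generated_pred A) (generated_divring A).

Definition generated_field (A : algC -> Prop) : subfieldC := generated_pred A.

(* autC K L is the group of automorphisms of L fixing K, under composition: the
   Galois group of L / K, finite or infinite, when L / K is Galois. *)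
Record autC (K L : subfieldC) := AutC {
  autC_fun :> field_of L -> field_of L;
  autC_inv : field_of L -> field_of L;
  autC_zmod : zmod_morphism autC_fun;
  autC_monoid : monoid_morphism autC_fun;
  autC_funK : cancel autC_fun autC_inv;
  autC_invK : cancel autC_inv autC_fun;
  autC_fix : forall x : field_of L, val x \in K -> autC_fun x = x
}.

HB.instance Definition _ (K L : subfieldC) (s : autC K L) :=
  GRing.isZmodMorphism.Build _ _ (autC_fun s) (autC_zmod s).
HB.instance Definition _ (K L : subfieldC) (s : autC K L) :=
  GRing.isMonoidMorphism.Build _ _ (autC_fun s) (autC_monoid s).
HB.instance Definition _ (K L : subfieldC) := gen_eqMixin (autC K L).
HB.instance Definition _ (K L : subfieldC) := gen_choiceMixin (autC K L).

Section AutGroup.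
Variables K L : subfieldC.
Implicit Types s t u : autC K L.

Lemma autCP s t : s =1 t -> s = t.
Proof.
case: s t => [f g fZ fM fK gK fx] [f' g' fZ' fM' fK' gK' fx'] /= e.
have e1 : f = f' by apply/funext.
subst f'.
have e2 : g = g' by apply/funext => x; rewrite -{1}(gK' x) fK.
by subst g'; congr AutC; apply: Prop_irrelevance.
Qed.

Fact autC_one_zmod : zmod_morphism (@id (field_of L)).
Proof. by []. Qed.
Fact autC_one_monoid : monoid_morphism (@id (field_of L)).
Proof. by []. Qed.
Fact autC_one_fix (x : field_of L) : val x \in K -> id x = x.
Proof. by []. Qed.
Definition autC_one : autC K L :=
  AutC autC_one_zmod autC_one_monoid
    (frefl id) (frefl id) autC_one_fix.

Fact autC_mul_zmod s t : zmod_morphism (s \o t).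
Proof. by move=> x y /=; rewrite !rmorphB. Qed.
Fact autC_mul_monoid s t : monoid_morphism (s \o t).
Proof. by split=> [|x y] /=; rewrite ?rmorph1 ?rmorphM. Qed.
Fact autC_mul_fix s t (x : field_of L) : val x \in K -> (s \o t) x = x.
Proof. by move=> xK /=; rewrite !autC_fix. Qed.
Definition autC_mul s t : autC K L :=
  AutC (autC_mul_zmod s t) (autC_mul_monoid s t)
    (can_comp (autC_funK s) (autC_funK t))
    (can_comp (autC_invK t) (autC_invK s))
    (@autC_mul_fix s t).

Fact autC_invg_zmod s : zmod_morphism (autC_inv s).
Proof.
move=> x y; apply: (can_inj (autC_funK s)).
by rewrite rmorphB /= !autC_invK.
Qed.
Fact autC_invg_monoid s : monoid_morphism (autC_inv s).
Proof.
split=> [|x y]; apply: (can_inj (autC_funK s)).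
- by rewrite rmorph1 /= autC_invK.
- by rewrite rmorphM /= !autC_invK.
Qed.
Fact autC_invg_fix s (x : field_of L) : val x \in K -> autC_inv s x = x.
Proof.
by move=> xK; apply: (can_inj (autC_funK s)); rewrite autC_invK autC_fix.
Qed.
Definition autC_invg s : autC K L :=
  AutC (autC_invg_zmod s) (autC_invg_monoid s) (autC_invK s) (autC_funK s)
    (@autC_invg_fix s).

Fact autC_mulA : associative autC_mul.
Proof. by move=> s t u; apply: autCP => x. Qed.
Fact autC_mul1 : left_id autC_one autC_mul.
Proof. by move=> s; apply: autCP => x. Qed.
Fact autC_1mul : right_id autC_one autC_mul.
Proof. by move=> s; apply: autCP => x. Qed.
Fact autC_mulV : left_inverse autC_one autC_invg autC_mul.
Proof. by move=> s; apply: autCP => x /=; rewrite autC_funK. Qed.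
Fact autC_Vmul : right_inverse autC_one autC_invg autC_mul.
Proof. by move=> s; apply: autCP => x /=; rewrite autC_invK. Qed.
End AutGroup.

HB.instance Definition _ (K L : subfieldC) := isGroup.Build (autC K L)
  (@autC_mulA K L) (@autC_mul1 K L) (@autC_1mul K L)
  (@autC_mulV K L) (@autC_Vmul K L).

(* Every extension in algC is algebraic and separable, so being Galois amounts
   to the fixed field of the automorphism group being K. *)
Definition galois_extension (K L : subfieldC) : Prop :=
  {subset K <= L} /\
  forall x : field_of L, (forall s : autC K L, s x = x) -> val x \in K.

Definition abelian_extension (K L : subfieldC) : Prop :=
  galois_extension K L /\ forall s t : autC K L, (s * t = t * s)%g.

Definition finite_extension (K L : subfieldC) : Prop :=
  {subset K <= L} /\
  exists (d : nat) (b : 'I_d -> field_of L), forall x : field_of L,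
    exists2 c : 'I_d -> field_of L,
      (forall i, val (c i) \in K) & x = \sum_i c i * b i.

(* The factor a makes the 0-th power the unit ideal. *)
Definition ideal_pow (R : comNzRingType) (I : {pred R}) (n : nat) (x : R) :
    Prop :=
  exists (m : nat) (a : 'I_m -> R) (y : 'I_m -> 'I_n -> R),
    (forall i j, y i j \in I) /\ x = \sum_i a i * \prod_j y i j.

Section Ramification.
Variables K L : subfieldC.

(* The ideal I O_L; b runs over the image of I in O_L, as there is no inclusion
   map from ringInt K to ringInt L. *)
Definition ext_ideal (I : {pred ringInt K}) (x : ringInt L) : Prop :=
  exists (m : nat) (a b : 'I_m -> ringInt L),
    (forall i, exists2 c : ringInt K, c \in I & val c = val (b i)) /\
    x = \sum_i a i * b i.

Definition lies_over (P : {pred ringInt L}) (p : {pred ringInt K}) : Prop :=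
  forall (c : ringInt K) (z : ringInt L),
    val c = val z -> (c \in p) = (z \in P).

(* e is the exponent of P in the factorization of the extension of p. *)
Definition is_ramification_index (p : {pred ringInt K})
    (P : {pred ringInt L}) (e : nat) : Prop :=
  (forall x, ext_ideal p x -> ideal_pow P e x) /\
  ~ (forall x, ext_ideal p x -> ideal_pow P e.+1 x).

(* Residue fields are finite, so there is no separability condition. *)
Definition unramified_at (p : prime_idealr (ringInt K)) : Prop :=
  forall P : prime_idealr (ringInt L),
    lies_over P p -> is_ramification_index p P 1.

(* No real place of K becomes complex in L; embeddings into the complex
   numbers take their values in algC. *)
Definition unramified_at_infinity : Prop :=
  forall tau : {rmorphism field_of L -> algC},
    (forall x : field_of L, val x \in K -> tau x \is Num.real) ->
    forall x : field_of L, tau x \is Num.real.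

(* L / K is unramified at all places, finite or infinite, that do not divide
   any of the rational primes in S. *)
Definition unramified_outside (S : {pred nat}) : Prop :=
  (forall p : prime_idealr (ringInt K),
     (exists2 c : ringInt K, c \in p & c != 0) ->
     (forall l : nat, l \in S -> l%:R \notin p) ->
     unramified_at p) /\
  unramified_at_infinity.
End Ramification.

(* The maximal abelian extension of K unramified outside S, as the compositum of
   all the finite ones. *)
Definition max_abelian_unramified_outside (K : subfieldC) (S : {pred nat}) :
    subfieldC :=
  generated_field (fun x => exists L : subfieldC,
    [/\ finite_extension K L, abelian_extension K L,
        unramified_outside K L S & x \in L]).

(* For an abelian group G written multiplicatively: G / G ^ 2 contains d
   linearly independent vectors over the field with two elements, i.e. its
   dimension, which may be infinite, is at least d. A linear combination is the
   product over the set A of indices whose coefficient is 1. *)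
Definition two_rank_ge (G : groupType) (d : nat) : Prop :=
  exists s : 'I_d -> G, forall A : {set 'I_d},
    (exists t : G, (\prod_(i in A) s i = t ^+ 2)%g) -> A = set0.

Definition cyclotomic_field (m : nat) : subfieldC :=
  generated_field (fun z => z ^+ m = 1).

Definition Qlayer (n : nat) : subfieldC :=
  generated_field (fun x =>
    x \in cyclotomic_field (2 ^ (n + 2)) /\ x \is Num.real).

(* As p is odd, the n-th layer of the cyclotomic Z_2-extension of Q(sqrt p) is
   the compositum of Q(sqrt p) with that of Q. *)
Definition Qlayer_sqrt (n p : nat) : subfieldC :=
  generated_field (fun x => x \in Qlayer n \/ x = sqrtC p%:R).

(* The Legendre symbol, for r an odd prime. *)
Definition legendre (a r : nat) : int :=
  if (r %| a)%N then 0
  else if [exists x : 'I_r, (x ^ 2 == a %[mod r])%N] then 1 else -1.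

(* Main.v *)
From HB Require Import structures.
Require Import Defs.
From mathcomp Require Import all_boot all_order all_algebra.
From mathcomp Require Import all_field boolp ring zify.

(** Write [K] for the base field and [M] for its maximal abelian extension
    unramified outside [2], [r].  Two explicit square roots generate totally
    real quadratic extensions of [K] inside [M]:
    - [sqrt r], whose square [r] is invertible outside [r];
    - [2 cos (2 pi / 2 ^ (n + 3))], a generator of the next layer of the
      cyclotomic tower, whose square lies in [K] and divides [4].
    Take an automorphism of [M] over [K] negating only the first of them, and
    another one negating only the second.  No nonempty product of the two is a
    square, because a square in the Galois group fixes every square root of an
    element of [K] ([two_rank_ge2_signs]).

    The two automorphisms come from cyclotomic ones
    ([cyclotomic_aut_exists]).  Since [r = 3 mod 4], [sqrt r] is
    [sqrt (-1) sqrt (- r)] with [sqrt (- r)] in the [r]-th cyclotomic field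
    ([half_product_sqr]); inverting the [r]-th roots of unity while fixing
    those of order [p] and a power of [2] negates it.  Mapping a primitive
    [2 ^ (n + 3)]-th root of unity to its opposite negates the other one.  Both
    automorphisms fix [K], as [sqrt p] lies in the [p]-th cyclotomic field.
    Every automorphism of the field of algebraic numbers fixing [K] restricts
    to [M], because Galois extensions are normal ([max_abelian_restrict]).

    It remains to see that [K (a)] is unramified at a prime [q] of [K] not
    containing [2 a ^ 2] ([quad_unramified_at]).  Let [P] lie over [q] and let
    [x -> x'] be the conjugation.  If [x] and [x'] are in [P], the identity
    [2 a ^ 2 x = a ^ 2 (x + x') + a (a x - a x')] puts [2 a ^ 2 x] in the
    extension of [q].  When [P] is stable under conjugation, this applies to
    all [x] in [P]; otherwise it applies to [y' x] for some fixed [y] in [P]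
    with [y'] not in [P].  So if the extension of [q] were contained in
    [P ^ 2], some [e] outside [P] would satisfy [e P] contained in [P ^ 2],
    which Nakayama's determinant trick forbids ([prime_ideal_nakayama]).  That
    argument needs [P] to be finitely generated, which follows from the
    finiteness of the ring of integers modulo a rational prime of [P]
    ([prime_ideal_fg]). *)

Set Implicit Arguments.
Unset Strict Implicit.
Unset Printing Implicit Defensive.

Import Order.TTheory GRing.Theory Num.Theory.
Local Open Scope ring_scope.

(** * Subfields and automorphisms of the field of algebraic numbers *)

Lemma generated_field_min (A : algC -> Prop) (S : {pred algC}) :
  divring_closed S -> (forall a, A a -> a \in S) ->
  {subset generated_field A <= S}.
Proof.
move=> clS AS x /asboolP xA.
pose SM := GRing.isDivringClosed.Build _ _ clS.
pose SF : subfieldC := HB.pack S SM.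
exact: (xA SF).
Qed.

Lemma sub_generated_field (A : algC -> Prop) (L : subfieldC) :
  (forall a, A a -> a \in L) -> {subset generated_field A <= L}.
Proof. by move=> AL x /asboolP; apply. Qed.

Lemma mem_generated_field (A : algC -> Prop) a : A a -> a \in generated_field A.
Proof. by move=> Aa; apply/asboolP => L; apply. Qed.

Lemma generated_field_fixed (A : algC -> Prop) (nu : {rmorphism algC -> algC}) :
  (forall a, A a -> nu a = a) -> {in generated_field A, nu =1 id}.
Proof.
move=> nuA x xA.
apply/eqP; move: xA.
apply: (@generated_field_min A [pred x | nu x == x]) => [|a /nuA] /=.
  split; first by rewrite inE rmorph1.
  - by move=> u v; rewrite !inE rmorphB => /eqP-> /eqP->.
  - by move=> u v; rewrite !inE fmorph_div => /eqP-> /eqP->.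
by rewrite inE => ->.
Qed.

Lemma generated_field_stable (A : algC -> Prop)
    (nu : {rmorphism algC -> algC}) :
  (forall a, A a -> nu a \in generated_field A) ->
  {in generated_field A, forall x, nu x \in generated_field A}.
Proof.
move=> nuA x xA.
apply: (@generated_field_min A [pred x | nu x \in generated_field A]) xA => //=.
split; first by rewrite inE rmorph1 rpred1.
- by move=> u v; rewrite !inE rmorphB => uA vA; rewrite rpredB.
- by move=> u v; rewrite !inE fmorph_div => uA vA; rewrite rpred_div.
Qed.

Lemma algC_invaut_fixed (K : {pred algC}) (nu : {rmorphism algC -> algC}) :
  {in K, nu =1 id} -> {in K, algC_invaut nu =1 id}.
Proof. by move=> nuK x xK; rewrite -{1}(nuK x xK) algC_autK. Qed.

(** A Galois extension is normal: the conjugates of [x] under [autC K L] are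
    finitely many, as they are roots of its minimal polynomial over the
    rationals, and the polynomial with exactly these roots is fixed by
    [autC K L], hence has its coefficients in [K]. *)
Lemma galois_extension_stable (K L : subfieldC)
    (nu : {rmorphism algC -> algC}) :
  galois_extension K L -> {in K, nu =1 id} ->
  {in L, forall x, nu x \in L}.
Proof.
move=> [sKL galL] nuK x0 Lx0; pose x := FieldOf Lx0.
pose conj y := `[< exists s : autC K L, y = s x >].
have [q [_ mon_q rootq]] := minCpolyP x0.
have ratrE (f : {rmorphism field_of L -> algC}) :
    map_poly f (map_poly ratr q) = map_poly ratr q.
  by rewrite -map_poly_comp; apply: eq_map_poly => a /=; rewrite fmorph_rat.
have qx0 : (map_poly ratr q).[x] = 0.
  apply: (fmorph_inj (val : {rmorphism field_of L -> algC})).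
  by rewrite rmorph0 -horner_map ratrE; apply/eqP; rewrite -/(root _ _) rootq.
have conj_root y : conj y -> root (map_poly ratr q : {poly algC}) (val y).
  case/asboolP=> s ->; rewrite -(ratrE ((val : {rmorphism _ -> _}) \o s)).
  by rewrite (rmorph_root ((val : {rmorphism _ -> _}) \o s)) // /root qx0.
have [rs Drs] := closed_field_poly_normal (map_poly ratr q : {poly algC}).
(* The list of conjugates, among the roots of the minimal polynomial. *)
pose sL : seq (field_of L) := undup [seq y <- pmap insub rs | conj y].
have sLP y : (y \in sL) = conj y.
  rewrite mem_undup mem_filter andb_idr // => /conj_root.
  rewrite mem_pmap_sub Drs rootZ ?root_prod_XsubC //.
  by rewrite lead_coef_map fmorph_eq0 lead_coef_eq0 monic_neq0.
pose Q := \prod_(y <- sL) ('X - y%:P).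
have fixQ (s : autC K L) : map_poly s Q = Q.
  rewrite rmorph_prod /=.
  under eq_bigr => y _ do rewrite rmorphB /= map_polyX map_polyC /=.
  rewrite -(big_map s xpredT (fun y => 'X - y%:P)).
  apply: perm_big; apply: uniq_perm; rewrite ?undup_uniq //.
    by rewrite map_inj_uniq ?undup_uniq //; apply: fmorph_inj.
  move=> y; apply/mapP/idP => [[z] | ]; rewrite !sLP.
    by case/asboolP=> t -> ->; apply/asboolP; exists (s * t)%g.
  case/asboolP=> t ->; exists ((s^-1 * t)%g x).
    by rewrite sLP; apply/asboolP; exists (s^-1 * t)%g.
  by rewrite /= autC_invK.
have QK i : val Q`_i \in K.
  by apply: galL => s; rewrite -[in RHS](fixQ s) coef_map.
pose QC : {poly algC} := map_poly val Q.
have nuQ : map_poly nu QC = QC.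
  apply/polyP => i; rewrite coef_map /QC coef_map; apply: nuK; exact: QK.
have QCE : QC = \prod_(z <- map val sL) ('X - z%:P).
  rewrite /QC rmorph_prod big_map; apply: eq_bigr => y _.
  by rewrite rmorphB; congr (_ - _); [apply: map_polyX | apply: map_polyC].
have : root QC (nu x0).
  rewrite -nuQ fmorph_root QCE root_prod_XsubC.
  apply/mapP; exists x; rewrite // sLP; apply/asboolP.
  by exists 1%g.
by rewrite QCE root_prod_XsubC => /mapP[y _ ->]; apply: valP.
Qed.

Lemma autC_restrict (K L : subfieldC) (nu : {rmorphism algC -> algC}) :
  {in K, nu =1 id} -> {in L, forall x, nu x \in L} ->
  {in L, forall x, algC_invaut nu x \in L} ->
  exists s : autC K L, forall x, val (s x) = nu (val x).
Proof.
move=> nuK nuL invL.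
pose f (x : field_of L) := FieldOf (nuL _ (valP x)).
pose g (x : field_of L) := FieldOf (invL _ (valP x)).
have fZ : zmod_morphism f by move=> x y; apply: val_inj; rewrite /= rmorphB.
have fM : monoid_morphism f.
  by split=> [|x y]; apply: val_inj; rewrite /= ?rmorph1 ?rmorphM.
have fK : cancel f g by move=> x; apply: val_inj; rewrite /= algC_autK.
have gK : cancel g f by move=> x; apply: val_inj; rewrite /= algC_invautK.
have f_fix (x : field_of L) : val x \in K -> f x = x.
  by move=> xK; apply: val_inj; apply: nuK.
by exists (AutC fZ fM fK gK f_fix).
Qed.

(** [M] is stable because each of the extensions generating it is Galois. *)
Lemma max_abelian_restrict (K : subfieldC) (S : {pred nat})
    (M := max_abelian_unramified_outside K S)
    (nu : {rmorphism algC -> algC}) :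
  {in K, nu =1 id} -> exists s : autC K M, forall x, val (s x) = nu (val x).
Proof.
have stab (mu : {rmorphism algC -> algC}) : {in K, mu =1 id} ->
    {in M, forall x, mu x \in M}.
  move=> muK; apply: generated_field_stable => x [L [finL abL unrL xL]].
  apply: mem_generated_field; exists L; split=> //.
  by case: abL => galL _; apply: (galois_extension_stable galL).
move=> nuK; apply: autC_restrict => //; first exact: stab.
by apply: stab; apply: algC_invaut_fixed.
Qed.

(** The automorphism [s] negates only [a] and [t] negates only [b], whereas a
    square in [autC K M] fixes both. *)
Lemma two_rank_ge2_signs (K : subfieldC) (M : subfieldC) (a b : algC)
    (s t : autC K M) (aM : a \in M) (bM : b \in M) :
  a != 0 -> b != 0 -> a ^+ 2 \in K -> b ^+ 2 \in K ->
  val (s (FieldOf aM)) = - a -> val (s (FieldOf bM)) = b ->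
  val (t (FieldOf aM)) = a -> val (t (FieldOf bM)) = - b ->
  two_rank_ge (autC K M) 2.
Proof.
move=> a0 b0 a2K b2K sa sb ta tb.
pose aL := FieldOf aM; pose bL := FieldOf bM.
have {sa} sa : s aL = - aL by apply: val_inj; rewrite sa.
have {sb} sb : s bL = bL by apply: val_inj; rewrite sb.
have {ta} ta : t aL = aL by apply: val_inj; rewrite ta.
have {tb} tb : t bL = - bL by apply: val_inj; rewrite tb.
have sqr_fix (u : autC K M) c (cM : c \in M) (cL := FieldOf cM) :
    c ^+ 2 \in K -> (u ^+ 2)%g cL = cL.
  move=> c2K; have : u (cL ^+ 2) == cL ^+ 2.
    by apply/eqP/autC_fix; rewrite rmorphXn.
  have uN : u (- cL) = - u cL by apply: rmorphN.
  rewrite rmorphXn eqf_sqr => /orP ucL.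
  suff : u (u cL) = cL by [].
  by case: ucL => /eqP E; have {}E : u cL = _ := E; rewrite !E ?uN ?E ?opprK.
have neqN c (cM : c \in M) (cL := FieldOf cM) : c != 0 -> - cL <> cL.
  move=> c0 /(congr1 val)/eqP; rewrite rmorphN /= eq_sym -addr_eq0 -mulr2n.
  by rewrite mulrn_eq0 (negPf c0).
exists (fun i => if i == 0 then s else t) => A [u uE].
set w := (\prod_(i in A) _)%g in uE.
have wE : w = ((if 0 \in A then s else 1) * (if 1%R \in A then t else 1))%g.
  rewrite /w big_mkcond !big_ord_recl big_ord0 /= mulg1.
  by rewrite (_ : lift ord0 ord0 = 1) //; apply: val_inj.
have wa : w aL = aL by rewrite uE; exact: (sqr_fix u a aM).
have wb : w bL = bL by rewrite uE; exact: (sqr_fix u b bM).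
have A0 : 0 \notin A.
  apply/negP => A0; move: wa; rewrite wE A0; case: ifP => _.
    change (s (t aL) = aL -> False); rewrite ta sa; exact: neqN.
  change (s aL = aL -> False); rewrite sa; exact: neqN.
have A1 : 1 \notin A.
  apply/negP => A1; move: wb; rewrite wE A1 (negPf A0).
  change (t bL = bL -> False); rewrite tb; exact: neqN.
apply/setP => i; rewrite inE; apply/negbTE.
case: (unliftP 0 i) => [j ->|-> //].
by rewrite (_ : lift 0 j = 1) //; apply: val_inj; rewrite /= ord1.
Qed.

(** * Quadratic extensions *)

(** The field [K (a)], used when [a ^ 2] is in [K]; [a] itself may be in [K]. *)
Definition quad_field (K : subfieldC) (a : algC) : subfieldC :=
  generated_field (fun x => x \in K \/ x = a).

Section QuadField.
Variables (K : subfieldC) (a : algC).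
Hypothesis a2K : a ^+ 2 \in K.
Let L := quad_field K a.

Lemma quad_field_base : {subset K <= L}.
Proof. by move=> x xK; apply: mem_generated_field; left. Qed.

Lemma quad_field_gen : a \in L.
Proof. by apply: mem_generated_field; right. Qed.

Lemma quad_fieldP x : x \in L ->
  exists u v, [/\ u \in K, v \in K & x = u + v * a].
Proof.
move=> xL; apply/asboolP; move: x xL.
pose S : {pred algC} :=
  [pred x | `[< exists u v, [/\ u \in K, v \in K & x = u + v * a] >]].
apply: (@generated_field_min _ S); last first.
  move=> x; rewrite inE => -[xK | ->]; apply/asboolP.
    by exists x, 0; rewrite rpred0 mul0r addr0.
  by exists 0, 1; rewrite rpred0 rpred1 mul1r add0r.
have SV x : x \in S -> x^-1 \in S.
  case/asboolP=> u [v [uK vK ->]]; apply/asboolP.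
  (* The norm vanishes on a nonzero element only if [a] is in [K]. *)
  have [n0 | n_neq0] := eqVneq (u ^+ 2 - v ^+ 2 * a ^+ 2) 0.
    have xK : u + v * a \in K.
      have [-> | v0] := eqVneq v 0; first by rewrite mul0r addr0.
      move/eqP: n0; rewrite -exprMn subr_sqr mulf_eq0 subr_eq0 addr_eq0.
      case/orP=> /eqP uva; last by rewrite uva addNr rpred0.
      by rewrite -uva rpredD.
    by exists (u + v * a)^-1, 0; rewrite rpredV // rpred0 mul0r addr0.
  set N := _ - _ in n_neq0.
  have NK : N \in K.
    by apply: rpredB; [apply: rpredX | apply: rpredM => //; apply: rpredX].
  exists (u / N), (- v / N); rewrite !rpred_div ?rpredN //; split=> //.
  have NE : N = (u + v * a) * (u - v * a) by rewrite /N -exprMn subr_sqr mulrC.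
  have x_neq0 : u + v * a != 0.
    by apply: contraNneq n_neq0 => x0; rewrite NE x0 mul0r.
  apply: (mulfI x_neq0); rewrite mulfV //.
  by rewrite mulrAC -mulrDl mulNr mulrA -NE mulfV.
split; first by apply/asboolP; exists 1, 0; rewrite rpred0 rpred1 mul0r addr0.
  move=> _ _ /asboolP[u [v [uK vK ->]]] /asboolP[u' [v' [u'K v'K ->]]].
  apply/asboolP; exists (u - u'), (v - v'); rewrite !rpredB //; split=> //.
  by rewrite mulrBl opprD addrACA.
move=> x y /asboolP[u [v [uK vK ->]]] /SV/asboolP[u' [v' [u'K v'K ->]]].
apply/asboolP; exists (u * u' + v * v' * a ^+ 2), (u * v' + v * u').
split; last by ring.
  by apply: rpredD; rewrite rpredM // rpredM.
by rewrite rpredD ?rpredM.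
Qed.

Lemma quad_finite : finite_extension K L.
Proof.
split; first exact: quad_field_base.
exists 2, (fun i => if i == 0 then 1 else FieldOf quad_field_gen) => x.
have [u [v [uK vK xE]]] := quad_fieldP (valP x).
exists (fun i : 'I_2 => if i == 0 then FieldOf (quad_field_base uK)
                        else FieldOf (quad_field_base vK)).
  by move=> i; case: eqP.
by apply: val_inj; rewrite !big_ord_recl big_ord0 /= mulr1 addr0.
Qed.

Variable sg : {rmorphism algC -> algC}.
Hypotheses (sgK : {in K, sg =1 id}) (sga : sg a = - a) (a_neq0 : a != 0).

Lemma quad_conj u v : u \in K -> v \in K -> sg (u + v * a) = u - v * a.
Proof.
by move=> uK vK; rewrite rmorphD rmorphM (sgK uK) (sgK vK) sga mulrN.
Qed.

Lemma quad_conj_stable : {in L, forall x, sg x \in L}.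
Proof.
move=> x /quad_fieldP[u [v [uK vK ->]]]; rewrite quad_conj //.
by rewrite rpredB ?rpredM ?quad_field_gen // quad_field_base.
Qed.

Lemma quad_conjK : {in L, forall x, sg (sg x) = x}.
Proof.
move=> x /quad_fieldP[u [v [uK vK ->]]]; rewrite quad_conj //.
by rewrite -mulNr quad_conj ?rpredN // mulNr opprK.
Qed.

Lemma quad_trace x : x \in L -> x + sg x \in K.
Proof.
move=> /quad_fieldP[u [v [uK vK ->]]]; rewrite quad_conj //.
by rewrite addrACA subrr addr0 rpredD.
Qed.

Lemma quad_autC_sign (s : autC K L) (aL := FieldOf quad_field_gen) :
  s aL = aL \/ s aL = - aL.
Proof.
have : s (aL ^+ 2) == aL ^+ 2 by apply/eqP/autC_fix; rewrite rmorphXn.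
rewrite rmorphXn eqf_sqr => /orP[] /eqP; [left | right] => //.
Qed.

Lemma quad_abelian : abelian_extension K L.
Proof.
split.
  split; first exact: quad_field_base.
  have invL : {in L, forall x, algC_invaut sg x \in L}.
    by move=> x xL; rewrite -(quad_conjK xL) algC_autK quad_conj_stable.
  have [s sE] := autC_restrict sgK quad_conj_stable invL.
  move=> x /(_ s)/(congr1 val); rewrite sE.
  have [u [v [uK vK ->]]] := quad_fieldP (valP x).
  rewrite quad_conj // => /addrI/eqP; rewrite eq_sym -addr_eq0 -mulr2n.
  rewrite mulrn_eq0 mulf_eq0 (negPf a_neq0) orbF => /eqP->.
  by rewrite mul0r addr0.
move=> s t; apply: autCP => x.
have [u [v [uK vK xE]]] := quad_fieldP (valP x).
pose aL := FieldOf quad_field_gen.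
have {xE} -> : x = FieldOf (quad_field_base uK) +
                   FieldOf (quad_field_base vK) * aL by apply: val_inj.
set uL := FieldOf _; set vL := FieldOf _.
have act (r : autC K L) b : r (uL + vL * b) = uL + vL * r b.
  by rewrite rmorphD rmorphM; congr (_ + _ * _); apply: autC_fix.
change (s (t (uL + vL * aL)) = t (s (uL + vL * aL))).
rewrite !act; congr (_ + _ * _).
have actN (r : autC K L) : r (- aL) = - r aL by apply: rmorphN.
have [] : s aL = aL \/ s aL = - aL := quad_autC_sign s;
  have [] : t aL = aL \/ t aL = - aL := quad_autC_sign t;
  by move=> ta sa; rewrite ?(sa, ta, actN).
Qed.

End QuadField.

(** * Prime ideals are finitely generated *)

(** Any [k > D] elements of [L] are linearly dependent over the rationals,
    expressed with integer coefficients: [L] has degree at most [D] over the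
    rationals. *)
Definition rational_rank_le (L : subfieldC) (D : nat) : Prop :=
  forall k (y : 'I_k -> algC), (D < k)%N -> (forall i, y i \in L) ->
    exists c : 'I_k -> int,
      (exists i, c i != 0) /\ \sum_i (c i)%:~R * y i = 0.

Lemma rational_rank_generated (A : algC -> Prop) (s : seq algC) :
  (forall a, A a -> a \in generated_field (fun x => x \in s)) ->
  exists D, rational_rank_le (generated_field A) D.
Proof.
move=> As; have [Q [QC [s1 Ds _]]] := num_field_exists s.
pose S : {pred algC} := [pred x | `[< exists y, x = QC y >]].
have clS : divring_closed S.
  split; first by apply/asboolP; exists 1; rewrite rmorph1.
  - move=> _ _ /asboolP[u ->] /asboolP[v ->].
    by apply/asboolP; exists (u - v); rewrite rmorphB.
  - move=> _ _ /asboolP[u ->] /asboolP[v ->].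
    by apply/asboolP; exists (u / v); rewrite fmorph_div.
have AS x : x \in generated_field A -> exists y, x = QC y.
  move=> xA; apply/asboolP; move: x xA.
  apply: (generated_field_min clS) => a /As.
  apply: (generated_field_min clS) => {}a; rewrite -Ds => /mapP[b _ ->].
  by apply/asboolP; exists b.
exists (\dim {: Q}) => k y ltDk yL.
have [z zE] := choice (fun i => AS _ (yL i)).
have : ~ (forall e : 'I_k -> rat,
    \sum_i e i *: [tuple z i | i < k]`_i = 0 -> forall i, e i = 0).
  move/freeP=> fz; move: (dimvS (subvf (span [tuple z i | i < k]))).
  by rewrite (eqP fz) size_tuple leqNgt ltDk.
case/existsNP=> e /not_implyP[e0 /existsNP[i ei_neq0]].
pose d := \prod_j denq (e j).
pose c j := numq (e j) * \prod_(j' | j' != j) denq (e j').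
have cE j : (c j)%:~R = d%:~R * e j :> rat.
  rewrite /d (bigD1 j) //= /c !intrM mulrAC; congr (_ * _).
  by rewrite -{3}(divq_num_den (e j)) mulrC divfK ?intr_eq0 ?denq_neq0.
exists c; split.
  exists i; rewrite -(intr_eq0 rat) cE mulf_neq0 //; last exact/eqP.
  by rewrite intr_eq0; apply/prodf_neq0 => j _; apply: denq_neq0.
have {}e0 : \sum_j e j *: z j = 0.
  by rewrite -[RHS]e0; apply: eq_bigr => j _; rewrite -tnth_nth tnth_mktuple.
transitivity (d%:~R * QC (\sum_j e j *: z j)); last by rewrite e0 rmorph0 mulr0.
rewrite rmorph_sum big_distrr /=; apply: eq_bigr => j _.
rewrite zE rmorphZ_num mulrA; congr (_ * _).
by rewrite -(ratr_int _ (c j)) cE rmorphM /= ratr_int.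
Qed.

(** Dividing a nontrivial relation by powers of [q] makes it nontrivial
    modulo [q]. *)
Lemma not_all_dvdz_relation (q : nat) k (y : 'I_k -> algC) (c : 'I_k -> int) :
  (1 < q)%N -> (exists i, c i != 0) -> \sum_i (c i)%:~R * y i = 0 ->
  exists2 c' : 'I_k -> int, (exists i, ~~ (q %| c' i)%Z)
    & \sum_i (c' i)%:~R * y i = 0.
Proof.
move=> q_gt1 [i ci].
have [N] := ubnP `|c i|%N.
elim: N => // N IHN in c ci *; rewrite ltnS => leN c0.
have [dvd_c | ] := pselect (forall j, (q %| c j)%Z); last first.
  by case/existsNP=> j /negP ndvd; exists c => //; exists j.
pose c1 j := (c j %/ q)%Z.
have c1E j : c j = c1 j * q by rewrite divzK.
apply: (IHN c1).
- by apply: contraNneq ci => c1i; rewrite c1E c1i mul0r.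
- apply: leq_trans leN; rewrite c1E abszM absz_nat ltn_Pmulr // absz_gt0.
  by apply: contraNneq ci => c1i; rewrite c1E c1i mul0r.
- apply: (mulfI (x := q%:R)); first by rewrite pnatr_eq0 -lt0n ltnW.
  rewrite mulr0 -[RHS]c0 big_distrr /=; apply: eq_bigr => j _.
  by rewrite c1E intrM mulrA; congr (_ * _); rewrite mulrC.
Qed.

Section Nakayama.
Variables (L : subfieldC) (D : nat).
Hypothesis rankL : rational_rank_le L D.
Let R := ringInt L.

(** Integers of [L] that are linearly independent modulo [q] are linearly
    independent over the rationals; so a family of elements of [P] independent
    modulo [q] has at most [D] elements, and one of maximal size generates [P]
    together with [q]. *)
Lemma prime_ideal_fg (P : prime_idealr R) (q : nat) :
  prime q -> q%:R \in P ->
  exists k (y : 'I_k -> R), (forall i, y i \in P) /\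
    forall x, x \in P -> exists c : 'I_k -> R, x = \sum_i c i * y i.
Proof.
move=> q_prime qP.
pose indep k (y : 'I_k -> R) := forall (c : 'I_k -> int) z,
  \sum_i (c i)%:~R * y i = q%:R * z -> forall i, (q %| c i)%Z.
pose good k := `[< exists y : 'I_k -> R, (forall i, y i \in P) /\ indep k y >].
have ex_good : exists k, good k.
  by exists 0%N; apply/asboolP; exists (fun=> 0); split=> [[] | c z _ []].
have good_le k : good k -> (k <= D)%N.
  case/asboolP=> y [_ indy]; rewrite leqNgt; apply/negP => ltDk.
  have [i|c [c_neq0 c0]] := rankL (y := fun i => val (y i)) ltDk.
    by case/andP: (valP (y i)).
  have [c' [i ndvd] c'0] := not_all_dvdz_relation (prime_gt1 q_prime) c_neq0 c0.
  apply/negP: ndvd; rewrite negbK; apply: (indy c' 0); apply: val_inj.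
  rewrite mulr0 rmorph0 -[RHS]c'0 rmorph_sum; apply: eq_bigr => j _.
  by rewrite rmorphM rmorph_int.
have [k /asboolP[y [yP indy]] max_k] := ex_maxnP ex_good good_le.
exists k.+1, (fun i => oapp y q%:R (unlift ord0 i)); split=> [i | x xP].
  by case: unliftP => [j|] _ /=.
pose y' i := oapp y x (unlift ord0 i).
have /existsNP[c /existsNP[z /not_implyP[cz /existsNP[i0 ndvd]]]] :
    ~ indep k.+1 y'.
  move=> indy'; have /max_k : good k.+1.
    apply/asboolP; exists y'; split=> // i; rewrite /y'.
    by case: unliftP => [j|] _ /=.
  by rewrite ltnn.
rewrite big_ord_recl {1}/y' unlift_none /= in cz.
have {}cz : (c ord0)%:~R * x + \sum_i (c (lift ord0 i))%:~R * y i = q%:R * z.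
  rewrite -cz; congr (_ + _); apply: eq_bigr => i _.
  by rewrite /y' liftK.
have ndvd0 : ~~ (q %| c ord0)%Z.
  apply/negP => dvd0; apply: ndvd.
  have dvdl : forall i, (q %| c (lift ord0 i))%Z.
    apply: (indy (fun i => c (lift ord0 i)) (z - (c ord0 %/ q)%Z%:~R * x)).
    rewrite mulrBr -cz mulrA mulrC -{1}(divzK dvd0) intrM mulrC.
    ring.
  by case: (unliftP ord0 i0) => [j|] ->.
(* The coefficient of [x] is invertible modulo [q]. *)
have : coprimez q (c ord0) by rewrite coprimezE /= prime_coprime.
case/coprimezP=> -[u v] /= uv1.
exists (fun i => oapp (fun j => - (v * c (lift ord0 j))%:~R)
                      (u%:~R * x + v%:~R * z) (unlift ord0 i)).
rewrite big_ord_recl unlift_none /=.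
under eq_bigr => i _ do rewrite liftK /= mulNr intrM -mulrA.
have uvR : u%:~R * q%:R + v%:~R * (c ord0)%:~R = 1 :> R.
  by have := congr1 (fun m : int => m%:~R : R) uv1; rewrite intrD !intrM.
rewrite sumrN -big_distrr /=.
transitivity ((u%:~R * q%:R + v%:~R * (c ord0)%:~R) * x).
  by rewrite uvR mul1r.
have -> : \sum_i (c (lift ord0 i))%:~R * y i = q%:R * z - (c ord0)%:~R * x.
  by rewrite -cz addrC addKr.
by ring.
Qed.

Lemma ideal_pow2E (P : prime_idealr R) x : ideal_pow P 2 x ->
  exists m (a b : 'I_m -> R),
    [/\ forall i, a i \in P, forall i, b i \in P & x = \sum_i a i * b i].
Proof.
case=> m [a [y [yP ->]]]; exists m, (fun i => a i * y i 0), (fun i => y i 1).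
split=> // [i|]; first exact: idealMr.
apply: eq_bigr => i _; rewrite !big_ord_recl big_ord0 mulr1 mulrA.
by congr (_ * y i _); apply: val_inj.
Qed.

(** Multiplication by [e] on generators of [P] is given by a matrix [M] with
    entries in [P], so [det (e - M)] kills [P], hence is zero; modulo [P] it is
    a power of [e]. *)
Lemma prime_ideal_nakayama (P : prime_idealr R) (q : nat) (e : R) :
  prime q -> q%:R \in P -> (forall x, x \in P -> ideal_pow P 2 (e * x)) ->
  e \in P.
Proof.
move=> q_prime qP eP.
have [k [y [yP genP]]] := prime_ideal_fg q_prime qP.
have [M0 M0P] : exists M : 'I_k -> 'I_k -> R, forall i,
    (forall j, M i j \in P) /\ e * y i = \sum_j M i j * y j.
  suff /choice[M MP] : forall i, exists Mi : 'I_k -> R,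
      (forall j, Mi j \in P) /\ e * y i = \sum_j Mi j * y j by exists M.
  move=> i.
  have [m [a [b [aP bP ->]]]] := ideal_pow2E (eP _ (yP i)).
  have [c cE] := choice (fun i => genP _ (bP i)).
  exists (fun j => \sum_h a h * c h j); split=> [j | ].
    by apply: rpred_sum => h _; rewrite mulrC idealMr.
  under eq_bigr => h _ do rewrite cE big_distrr /=.
  rewrite exchange_big; apply: eq_bigr => j _; rewrite big_distrl /=.
  by apply: eq_bigr => h _; rewrite mulrA.
pose M := \matrix_(i, j) M0 i j.
pose v := \col_i y i.
have Mv : (e%:M - M) *m v = 0.
  rewrite mulmxBl mul_scalar_mx; apply/colP => i; rewrite !mxE.
  apply/eqP; rewrite (M0P i).2 subr_eq0; apply/eqP; apply: eq_bigr => j _.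
  by rewrite !mxE.
have det0 i : \det (e%:M - M) * y i = 0.
  have : \adj (e%:M - M) *m ((e%:M - M) *m v) = 0 by rewrite Mv mulmx0.
  by rewrite mulmxA mul_adj_mx mul_scalar_mx => /colP/(_ i); rewrite !mxE.
have q_neq0 : q%:R != 0 :> R.
  apply/eqP => /(congr1 val)/eqP; rewrite rmorph_nat rmorph0 pnatr_eq0.
  by rewrite -leqn0 leqNgt prime_gt0.
have {}det0 : \det (e%:M - M) = 0.
  have [c qE] := genP _ qP.
  have : \det (e%:M - M) * q%:R = 0.
    rewrite qE big_distrr big1 //= => i _.
    by rewrite mulrCA det0 mulr0.
  move/(congr1 val); rewrite rmorphM rmorph0 => /eqP; rewrite mulf_eq0.
  case/orP=> /eqP E; apply: val_inj; rewrite ?E ?rmorph0 //.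
  by case/negP: q_neq0; apply/eqP/val_inj; rewrite E rmorph0.
pose f : {rmorphism R -> {ideal_quot P}} := \pi_{ideal_quot P}%qT.
have fP x : (f x == 0) = (x \in P).
  by rewrite -(rmorph0 f) -[in RHS](subr0 x) -Quotient.idealrBE.
have : f (\det (e%:M - M)) == 0 by rewrite det0 rmorph0.
rewrite -det_map_mx map_mxB map_scalar_mx.
have -> : map_mx f M = 0.
  by apply/matrixP => i j; rewrite !mxE; apply/eqP; rewrite fP (M0P i).1.
rewrite subr0 det_scalar -rmorphXn fP.
elim: k {y yP genP M0 M0P M v Mv det0} => [|k IHk]; first by rewrite idealr1.
by rewrite exprS prime_idealrM => /orP[].
Qed.
End Nakayama.

(** * Ramification in quadratic extensions *)

(** After removing powers of the variable, [m] is the constant term of [f]. *)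
Lemma int_poly_root_multiple (f : {poly int}) (c : algC) :
  f != 0 -> c != 0 -> root (map_poly intr f) c ->
  exists m (g : {poly int}), m != 0 /\ m%:~R = c * (map_poly intr g).[c].
Proof.
move=> f_neq0 c_neq0; elim/poly_ind: f f_neq0 => [|g m IHg f_neq0].
  by rewrite eqxx.
rewrite rmorphD rmorphM /= map_polyX map_polyC rootE hornerMXaddC.
have [m0 gc | m_neq0 /eqP gc] := eqVneq m 0.
  apply: IHg.
    by apply: contraNneq f_neq0 => ->; rewrite m0 mul0r addr0.
  by move: gc; rewrite m0 addr0 mulf_eq0 (negPf c_neq0) orbF.
exists m, (- g); split=> //; rewrite rmorphN hornerN mulrN [c * _]mulrC.
by apply/eqP; rewrite -addr_eq0 addrC gc.
Qed.

Lemma prime_ideal_contains_prime (K : subfieldC)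
    (P : prime_idealr (ringInt K)) :
  (exists2 c : ringInt K, c \in P & c != 0) ->
  exists2 q : nat, prime q & q%:R \in P.
Proof.
case=> c cP c_neq0.
have vc_neq0 : val c != 0.
  by apply: contraNneq c_neq0 => vc0; apply/eqP/val_inj; rewrite vc0 rmorph0.
have [m mP m_gt0] : exists2 m : nat, m%:R \in P & (0 < m)%N.
  have /andP[_ /floorpP[f Df]] := valP c.
  have [| | m [g [m_neq0 mE]]] := @int_poly_root_multiple f (val c) _ vc_neq0.
  - by apply: contraTneq (minCpoly_monic (val c)) => f0;
      rewrite Df f0 map_poly0 monicE lead_coef0 eq_sym oner_eq0.
  - by rewrite -Df root_minCpoly.
  have mc : m%:~R = (map_poly intr g).[c] * c.
    apply: val_inj; rewrite rmorph_int rmorphM mE mulrC; congr (_ * _).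
    rewrite -horner_map -map_poly_comp; congr _.[_].
    apply: eq_map_poly => z; apply/esym.
    by rewrite -(rmorph_int (val : {rmorphism ringInt K -> algC})).
  exists `|m|%N; last by rewrite absz_gt0.
  have mP : m%:~R \in P by rewrite mc idealMr.
  rewrite pmulrn abszEsign intrM rmorph_sign.
  by rewrite idealMr.
have [N] := ubnP m; elim: N => // N IHN in m mP m_gt0 *; rewrite ltnS => leN.
have [m_gt1 | m_le1] := ltnP 1 m; last first.
  have m1 : m = 1%N by apply/eqP; rewrite eqn_leq m_le1.
  by move: mP; rewrite m1 idealr1.
move: mP; rewrite -{1}(divnK (pdiv_dvd m)) natrM prime_idealrM.
case/orP=> [mP | qP]; last by exists (pdiv m); rewrite ?pdiv_prime.
apply: IHN mP _ _; first by rewrite divn_gt0 ?pdiv_gt0 // pdiv_leq.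
by apply: leq_trans leN; rewrite ltn_Pdiv // prime_gt1 // pdiv_prime.
Qed.

Section QuadUnramified.
Variables (K : subfieldC) (a : algC) (D : nat) (sg : {rmorphism algC -> algC}).
Hypotheses (a_int : a \in Aint) (a2K : a ^+ 2 \in K).
Hypotheses (sgK : {in K, sg =1 id}) (sga : sg a = - a).
Let L := quad_field K a.
Hypothesis rankL : rational_rank_le L D.

Let stabL := quad_conj_stable a2K sgK sga.

Fact quad_gen_int : a \in integral_in L.
Proof. by apply/andP; split=> //; apply: quad_field_gen. Qed.

Fact quad_conj_int (x : ringInt L) : sg (val x) \in integral_in L.
Proof.
have /andP[xL xA] := valP x; apply/andP; split; first exact: stabL.
by rewrite Aint_aut.
Qed.

Let al := RingInt quad_gen_int.
Let conj (x : ringInt L) := RingInt (quad_conj_int x).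

Fact quad_base_trace (x : ringInt L) :
  exists t : ringInt K, val t = val x + sg (val x).
Proof.
have /andP[xL xA] := valP x.
suff tK : val x + sg (val x) \in integral_in K by exists (RingInt tK).
apply/andP; split; first exact: (quad_trace a2K sgK sga).
by rewrite rpredD // Aint_aut.
Qed.

(** With traces taken over [K], [2 a ^ 2 x = a ^ 2 Tr x + a Tr (a x)], and both
    traces are in [p]. *)
Lemma quad_ext_ideal (p : prime_idealr (ringInt K))
    (P : prime_idealr (ringInt L)) (x : ringInt L) :
  lies_over P p -> x \in P -> conj x \in P -> ext_ideal p (2%:R * al ^+ 2 * x).
Proof.
move=> Pp xP cxP.
have [t tE] := quad_base_trace x.
have [w wE] := quad_base_trace (al * x).
have tLP : x + conj x \in P by rewrite rpredD.
have wLP : al * (x - conj x) \in P by rewrite idealMr // rpredB.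
have tE' : val t = val (x + conj x) by rewrite tE rmorphD.
have tp : t \in p by rewrite (Pp _ _ tE').
have wE' : val w = val (al * (x - conj x)).
  by rewrite wE !rmorphM rmorphB /= sga; ring.
have wp : w \in p by rewrite (Pp _ _ wE').
exists 2, (fun i => if i == 0 then al ^+ 2 else al),
  (fun i => if i == 0 then x + conj x else al * (x - conj x)); split.
  by move=> i; case: eqP => _; [exists t | exists w].
by rewrite !big_ord_recl big_ord0 /=; ring.
Qed.

Lemma quad_unramified_at (p : prime_idealr (ringInt K)) :
  (exists2 c : ringInt K, c \in p & c != 0) ->
  2%:R \notin p -> (forall c : ringInt K, val c = a ^+ 2 -> c \notin p) ->
  unramified_at L p.
Proof.
move=> p_neq0 two_p a2_p P Pp.
have [q q_prime qp] := prime_ideal_contains_prime p_neq0.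
have natP (m : nat) : (m%:R \in P) = (m%:R \in p).
  by rewrite -(Pp m%:R m%:R) // !rmorph_nat.
split.
  move=> x [m [u [v [vP ->]]]]; exists m, u, (fun i _ => v i); split.
    by move=> i _; have [c cp cE] := vP i; rewrite -(Pp _ _ cE).
  by apply: eq_bigr => i _; rewrite big_ord_recl big_ord0 mulr1.
move=> P2.
have alP : al ^+ 2 \notin P.
  have a2A : a ^+ 2 \in integral_in K by apply/andP; split=> //; apply: rpredX.
  rewrite -(Pp (RingInt a2A)); first exact: a2_p.
  by rewrite rmorphXn.
have dP : 2%:R * al ^+ 2 \notin P.
  by rewrite prime_idealrM negb_or natP two_p.
have [stabP | ] := pselect (forall x, x \in P -> conj x \in P).
  apply: (negP dP); apply: (prime_ideal_nakayama rankL q_prime).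
    by rewrite natP.
  by move=> x xP; apply: P2; apply: (quad_ext_ideal Pp) => //; apply: stabP.
(* Multiplying by [conj y] brings elements of [P] into the intersection of [P]
   with its conjugate. *)
case/existsNP=> y /not_implyP[yP /negP cyP].
have : 2%:R * al ^+ 2 * conj y \in P; last first.
  by apply/negP; rewrite prime_idealrM negb_or dP.
apply: (prime_ideal_nakayama rankL q_prime); first by rewrite natP.
move=> x xP; apply: P2; rewrite -mulrA; apply: (quad_ext_ideal Pp).
  by rewrite idealMr.
have -> : conj (conj y * x) = conj x * y.
  apply: val_inj; rewrite /= rmorphM mulrC; congr (_ * _).
  by apply: (quad_conjK a2K sgK sga); case/andP: (valP y).
by rewrite idealMr.
Qed.

End QuadUnramified.

(** It suffices to test the real places on the generator [a]. *)
Lemma quad_max_abelian (K : subfieldC) (S : {pred nat}) (a : algC) (D : nat)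
    (sg : {rmorphism algC -> algC}) :
  a \in Aint -> a ^+ 2 \in K -> a != 0 ->
  {in K, sg =1 id} -> sg a = - a ->
  rational_rank_le (quad_field K a) D ->
  2%N \in S ->
  (forall p : prime_idealr (ringInt K), (forall l, l \in S -> l%:R \notin p) ->
     forall c, val c = a ^+ 2 -> c \notin p) ->
  (forall tau : {rmorphism field_of (quad_field K a) -> algC},
     tau (FieldOf (quad_field_gen K a)) \is Num.real) ->
  a \in max_abelian_unramified_outside K S.
Proof.
move=> a_int a2K a_neq0 sgK sga rankL S2 a2S a_real.
apply: mem_generated_field; exists (quad_field K a); split.
- exact: quad_finite.
- exact: (quad_abelian a2K sgK sga a_neq0).
- split=> [p p_neq0 pS | tau tauK x].
    by apply: (quad_unramified_at a_int a2K sgK sga rankL p_neq0);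
      [apply: pS | apply: a2S].
  have [u [v [uK vK xE]]] := quad_fieldP a2K (valP x).
  have -> : x = FieldOf (quad_field_base a uK) +
      FieldOf (quad_field_base a vK) * FieldOf (quad_field_gen K a).
    exact: val_inj.
  by rewrite rmorphD rmorphM rpredD ?rpredM //; apply: tauK.
- exact: quad_field_gen.
Qed.

(** * Cyclotomic automorphisms and quadratic irrationalities *)

Lemma cyclotomic_aut_exists m1 m2 k1 k2 :
  coprime m1 m2 -> coprime k1 m1 -> coprime k2 m2 ->
  exists nu : {rmorphism algC -> algC},
    (forall z, z ^+ m1 = 1 -> nu z = z ^+ k1) /\
    (forall z, z ^+ m2 = 1 -> nu z = z ^+ k2).
Proof.
move=> co_m co1 co2; pose k := chinese m1 m2 k1 k2.
have co_k : coprime k (m1 * m2).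
  rewrite coprimeMr -!(coprime_modl k) chinese_modl // chinese_modr //.
  by rewrite !coprime_modl co1.
have [nu nuE] := Qn_aut_exists co_k.
have reduce m k' z : k = k' %[mod m] -> z ^+ m = 1 -> z ^+ k = z ^+ k' :> algC.
  move=> kE zm; rewrite (divn_eq k m) (divn_eq k' m) kE.
  by rewrite !exprD !(mulnC _ m) !exprM zm !expr1n.
exists nu; split=> z zm.
  rewrite nuE; last by rewrite exprM zm expr1n.
  by apply: reduce zm; apply: chinese_modl.
rewrite nuE; last by rewrite mulnC exprM zm expr1n.
by apply: reduce zm; apply: chinese_modr.
Qed.

(** When [z] is a primitive root of unity of odd order [q = 2 h + 1], this is a
    square root of [(-1) ^ h q]; replacing [z] by its inverse multiplies it by
    [(-1) ^ h]. *)
Definition half_product (h : nat) (z : algC) : algC :=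
  \prod_(k < h) (z ^+ k.+1 - z ^- k.+1).

Lemma half_product_aut (nu : {rmorphism algC -> algC}) h z :
  nu z = z -> nu (half_product h z) = half_product h z.
Proof.
move=> nuz; rewrite rmorph_prod; apply: eq_bigr => k _.
by rewrite rmorphB fmorphV !rmorphXn /= nuz.
Qed.

Lemma half_product_autV (nu : {rmorphism algC -> algC}) h z :
  nu z = z^-1 -> nu (half_product h z) = (-1) ^+ h * half_product h z.
Proof.
move=> nuz; rewrite rmorph_prod -[in (-1) ^+ h](card_ord h) -prodr_const.
rewrite -big_split; apply: eq_bigr => k _ /=.
by rewrite rmorphB fmorphV !rmorphXn /= nuz exprVn invrK mulN1r opprB.
Qed.

Lemma half_product_Aint h z q :
  (0 < q)%N -> z ^+ q = 1 -> half_product h z \in Aint.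
Proof.
move=> q_gt0 zq; have zA : z \in Aint.
  by apply: (Aint_unity_root q_gt0); apply/unity_rootP.
have zVA : z^-1 \in Aint.
  by apply: (Aint_unity_root q_gt0); apply/unity_rootP; rewrite exprVn zq invr1.
by apply: rpred_prod => k _; rewrite rpredB -?exprVn ?rpredX.
Qed.

Lemma prod_one_sub_root n (z : algC) : n.+1.-primitive_root z ->
  \prod_(k < n) (1 - z ^+ k.+1) = n.+1%:R.
Proof.
move=> prim_z; have := factor_Xn_sub_1 prim_z.
rewrite big_mkord big_ord_recl expr0 subrX1.
move/(mulfI (negbT (polyXsubC_eq0 1))) => E.
transitivity (\sum_(i < n.+1) 'X^i : {poly algC}).[1].
  rewrite -E horner_prod; apply: eq_bigr => k _.
  by rewrite hornerXsubC.
rewrite horner_sum; under eq_bigr => k _ do rewrite hornerXn expr1n.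
by rewrite sumr_const card_ord.
Qed.

Lemma primitive_root_neq0 n (z : algC) : n.-primitive_root z -> z != 0.
Proof.
move=> prim_z; have := oner_neq0 algC; rewrite -(prim_expr_order prim_z).
by rewrite expf_eq0 (prim_order_gt0 prim_z).
Qed.

(** With [w = z ^ 2], [(z ^ k - z ^- k) ^ 2 = - (1 - w ^ k) (1 - w ^- k)], and
    the product of all the [1 - w ^ k] is the order of [w]. *)
Lemma half_product_sqr h z : h.*2.+1.-primitive_root z ->
  half_product h z ^+ 2 = (-1) ^+ h * h.*2.+1%:R.
Proof.
move=> prim_z; have prim_z2 : h.*2.+1.-primitive_root (z ^+ 2).
  by rewrite prim_root_exp_coprime // coprime2n /= odd_double.
have z_neq0 : z != 0 by apply: primitive_root_neq0 prim_z.
rewrite -(prod_one_sub_root prim_z2) -addnn big_split_ord /=.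
(* Pair the index [k] with [2 h + 1 - k]. *)
rewrite [X in _ * (_ * X)](reindex_inj rev_ord_inj) /= -big_split /=.
rewrite -[in (-1) ^+ h](card_ord h) -prodr_const -big_split /=.
rewrite /half_product -prodrXl.
apply: eq_bigr => k _.
have -> : z ^+ 2 ^+ (h + (h - k.+1)).+1 = (z ^+ 2) ^- k.+1.
  apply: (mulIf (x := (z ^+ 2) ^+ k.+1)); first by rewrite !expf_neq0.
  rewrite mulVf ?expf_neq0 // -exprD.
  have -> : ((h + (h - k.+1)).+1 + k.+1 = h.*2.+1)%N by have := ltn_ord k; lia.
  exact: prim_expr_order.
rewrite -!exprM mulnC exprM.
have : z ^+ k.+1 != 0 by rewrite expf_neq0.
by move: (z ^+ k.+1) => x x_neq0; field.
Qed.

(** [2 cos t] when [z = exp (i t)]. *)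
Definition double_cos (z : algC) : algC := z + z^-1.

Lemma double_cos_sqr z : z != 0 -> double_cos z ^+ 2 = double_cos (z ^+ 2) + 2.
Proof. by move=> z_neq0; rewrite /double_cos; field. Qed.

Lemma sqr_real_nneg (y : algC) : 0 <= y ^+ 2 -> y \is Num.real.
Proof.
move=> y2; have : y ^+ 2 == sqrtC (y ^+ 2) ^+ 2 by rewrite sqrtCK.
rewrite eqf_sqr => /orP[] /eqP ->; rewrite ?rpredN ger0_real // sqrtC_ge0 //.
Qed.

(** In the complex numbers, the preimage of the interval [[-2, 2]]
    under [x ^ 2 - 2] is itself. *)
Lemma iter_sqr_sub2_real j (y : algC) :
  iter j (fun x => x ^+ 2 - 2) y = 0 -> (y \is Num.real) && (-2 <= y <= 2).
Proof.
elim: j y => [|j IHj] y.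
  by move=> /= ->; rewrite rpred0 lerNl oppr0 ler0n.
rewrite iterSr => /IHj/and3P[_ y2_ge y2_le].
have y2_ge0 : 0 <= y ^+ 2 by rewrite -(lerD2r (- 2)) add0r.
have yR := sqr_real_nneg y2_ge0; rewrite yR -real_ler_norml //=.
rewrite -ler_sqr ?nnegrE // real_normK // -(lerD2r (- 2)).
by apply: le_trans y2_le _; rewrite -natrX -natrB.
Qed.

Lemma double_cos_iter j z : z != 0 ->
  iter j (fun x => x ^+ 2 - 2) (double_cos z) = double_cos (z ^+ (2 ^ j)).
Proof.
elim: j z => [|j IHj] z z_neq0; first by rewrite expr1.
rewrite iterSr double_cos_sqr // addrK IHj ?expf_neq0 //.
by rewrite -exprM -expnS.
Qed.

Lemma primitive_root_half m (z : algC) : (0 < m)%N ->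
  m.*2.-primitive_root z -> z ^+ m = -1.
Proof.
move=> m_gt0 prim_z; have : (z ^+ m) ^+ 2 == 1.
  by rewrite -exprM muln2 (prim_expr_order prim_z).
rewrite sqrf_eq1 => /orP[|/eqP //].
by rewrite -(prim_order_dvd prim_z) gtnNdvd // -addnn -ltn_subLR // subnn.
Qed.

(** With [w = - z ^+ 2], also of order [2 ^ m.+2], [1 - w] divides
    [1 - w ^+ (2 ^ m.+1) = 2]. *)
Lemma double_cos_dvd2 m (z : algC) : (2 ^ m.+3).-primitive_root z ->
  exists2 b, b \in Aint & double_cos z * b = 2.
Proof.
move=> prim_z; have zA := Aint_prim_root prim_z.
have z_neq0 : z != 0 by apply: primitive_root_neq0 prim_z.
exists (z * \sum_(i < 2 ^ m.+1) (- z ^+ 2) ^+ i).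
  apply: rpredM => //; apply: rpred_sum => i _.
  by rewrite rpredX // rpredN rpredX.
rewrite mulrA mulrDl mulVf // -expr2 [_ + 1]addrC -[X in 1 + X]opprK.
have := subrX1 (- z ^+ 2) (2 ^ m.+1).
rewrite exprNn -exprM -signr_odd oddX /= mul1r -expnS.
rewrite (primitive_root_half (m := 2 ^ m.+2)) ?expn_gt0 //.
  by move=> E; rewrite -[1 - _]opprB mulNr -E opprB opprK.
by rewrite -muln2 -expnSr.
Qed.

Lemma cyclotomic_field_fixed m (nu : {rmorphism algC -> algC}) :
  (forall z, z ^+ m = 1 -> nu z = z) -> {in cyclotomic_field m, nu =1 id}.
Proof. exact: generated_field_fixed. Qed.

(** * The base field *)

Section Layers.
Variables (n p : nat).
Let K := Qlayer_sqrt n p.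

Lemma Qlayer_sqrt_fixed (nu : {rmorphism algC -> algC}) :
  {in cyclotomic_field (2 ^ (n + 2)), nu =1 id} ->
  nu (sqrtC p%:R) = sqrtC p%:R -> {in K, nu =1 id}.
Proof.
move=> nuC nu_p; apply: generated_field_fixed => x [|->//].
by apply: generated_field_fixed => y [yC _]; apply: nuC.
Qed.

Lemma quad_Qlayer_sqrt_rank (a : algC) :
  exists D, rational_rank_le (quad_field K a) D.
Proof.
have [z prim_z] := C_prim_root_exists (expn_gt0 2 (n + 2)).
apply: (@rational_rank_generated _ [:: z; sqrtC p%:R; a]) => x [|->];
  last first.
  by apply: mem_generated_field; rewrite !inE eqxx !orbT.
move: x; apply: sub_generated_field => x [|->]; last first.
  by apply: mem_generated_field; rewrite !inE eqxx !orbT.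
move: x; apply: sub_generated_field => x [+ _].
move: x; apply: sub_generated_field => x /(prim_rootP prim_z)[i ->].
by apply: rpredX; apply: mem_generated_field; rewrite !inE eqxx.
Qed.

Lemma double_cos_Qlayer_sqrt z :
  z ^+ (2 ^ (n + 2)) = 1 -> double_cos z \in K.
Proof.
move=> z1; apply: mem_generated_field; left; apply: mem_generated_field.
have zC : z \in cyclotomic_field (2 ^ (n + 2)) by apply: mem_generated_field.
split; first by rewrite rpredD ?rpredV.
have n1 : `|z| = 1.
  apply/eqP; rewrite -(pexpr_eq1 (n := 2 ^ (n + 2))) ?expn_gt0 //.
  by rewrite -normrX z1 normr1.
have zV : z^-1 = z^* by rewrite invC_norm n1 expr1n invr1 mul1r.
by apply/CrealP; rewrite /double_cos zV rmorphD /= conjCK addrC.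
Qed.
End Layers.

Lemma sqrtC_half_product h z : ~~ odd h -> h.*2.+1.-primitive_root z ->
  sqrtC h.*2.+1%:R = half_product h z \/
  sqrtC h.*2.+1%:R = - half_product h z.
Proof.
move=> h_even prim_z; have : sqrtC h.*2.+1%:R ^+ 2 == half_product h z ^+ 2.
  by rewrite sqrtCK half_product_sqr // -signr_odd (negPf h_even) mul1r.
by rewrite eqf_sqr => /orP[] /eqP; [left | right].
Qed.

Lemma sqrtC_fixed h (nu : {rmorphism algC -> algC}) : ~~ odd h ->
  (forall z, z ^+ h.*2.+1 = 1 -> nu z = z) ->
  nu (sqrtC h.*2.+1%:R) = sqrtC h.*2.+1%:R.
Proof.
move=> h_even nu_z; have [z prim_z] := C_prim_root_exists (ltn0Sn h.*2).
have nuD : nu (half_product h z) = half_product h z.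
  by apply: half_product_aut; apply: nu_z; apply: prim_expr_order.
by case: (sqrtC_half_product h_even prim_z) => ->; rewrite ?rmorphN /= nuD.
Qed.

(** * Two quadratic extensions and their automorphisms *)

Section TwoExtensions.
Variables (n p r : nat) (S : {pred nat}).
Let K := Qlayer_sqrt n p.
Hypotheses (p_prime : prime p) (r_prime : prime r).
Hypotheses (p_mod4 : p = 1 %[mod 4]) (r_mod4 : r = 3 %[mod 4]).
Variables (z w : algC).
Hypotheses (z_prim : (2 ^ n.+3).-primitive_root z)
           (w_prim : r.-primitive_root w).

Let pE : p = p./2.*2.+1. Proof. by clear -p_mod4; lia. Qed.
Let p2_even : ~~ odd p./2. Proof. by clear -p_mod4; lia. Qed.
Let rE : r = r./2.*2.+1. Proof. by clear -r_mod4; lia. Qed.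
Let r2_odd : odd r./2. Proof. by clear -r_mod4; lia. Qed.

(** A square root of [r]: [z ^+ (2 ^ n.+1)] is a square root of [-1] and
    [half_product r./2 w] is a square root of [- r]. *)
Definition sqrt_r : algC := z ^+ (2 ^ n.+1) * half_product r./2 w.

Let z_expr2 : z ^+ (2 ^ n.+2) = -1.
Proof. by apply: primitive_root_half; rewrite ?expn_gt0 // -muln2 -expnSr. Qed.

Lemma sqrt_r_sqr : sqrt_r ^+ 2 = r%:R.
Proof.
rewrite exprMn -exprM -expnSr z_expr2 half_product_sqr -?rE //.
by rewrite -signr_odd r2_odd mulrA mulrNN !mul1r.
Qed.

Lemma sqrt_r_Aint : sqrt_r \in Aint.
Proof.
rewrite rpredM ?rpredX ?(Aint_prim_root z_prim) //.
exact: half_product_Aint (prime_gt0 r_prime) (prim_expr_order w_prim).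
Qed.

Lemma sqrt_r_neq0 : sqrt_r != 0.
Proof.
by rewrite -sqrf_eq0 sqrt_r_sqr pnatr_eq0 -lt0n prime_gt0.
Qed.

Lemma double_cos_neq0 : double_cos z != 0.
Proof.
have [b _ E] := double_cos_dvd2 z_prim.
by apply: contra_eq_neq E => ->; rewrite mul0r eq_sym pnatr_eq0.
Qed.

Lemma double_cos_Aint : double_cos z \in Aint.
Proof.
rewrite rpredD ?(Aint_prim_root z_prim) //.
rewrite (Aint_unity_root (n := 2 ^ n.+3)) ?expn_gt0 //.
by apply/unity_rootP; rewrite exprVn (prim_expr_order z_prim) invr1.
Qed.

Lemma double_cos_sqr_Qlayer_sqrt : double_cos z ^+ 2 \in K.
Proof.
rewrite double_cos_sqr ?(primitive_root_neq0 z_prim) // rpredD ?rpred_nat //.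
apply: double_cos_Qlayer_sqrt.
by rewrite -exprM -expnS addn2 (prim_expr_order z_prim).
Qed.

Let p_odd : odd p. Proof. by clear -p_mod4; lia. Qed.
Let r_odd : odd r. Proof. by clear -r_mod4; lia. Qed.
Let coprime_pr : coprime p r.
Proof.
rewrite prime_coprime // dvdn_prime2 //; apply/eqP => prE.
by move: p_mod4; rewrite prE r_mod4.
Qed.

Lemma Qlayer_sqrt_fixed_roots (nu : {rmorphism algC -> algC}) :
  (forall x, x ^+ (2 ^ (n + 2)) = 1 -> nu x = x) ->
  (forall x, x ^+ p = 1 -> nu x = x) -> {in K, nu =1 id}.
Proof.
move=> nu2 nup; apply: Qlayer_sqrt_fixed; first exact: cyclotomic_field_fixed.
by rewrite pE; apply: sqrtC_fixed; rewrite -?pE.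
Qed.

(** The automorphism inverts the [r]-th roots of unity and fixes those of order
    dividing [2 ^ n.+3 * p]. *)
Lemma negate_sqrt_r : exists nu : {rmorphism algC -> algC},
  [/\ {in K, nu =1 id}, nu sqrt_r = - sqrt_r
    & nu (double_cos z) = double_cos z].
Proof.
have [|||nu [nu1 nu2]] := @cyclotomic_aut_exists (2 ^ n.+3 * p) r 1 r.-1.
- by rewrite coprimeMl coprime_pr coprimeXl // coprime2n.
- by rewrite coprime1n.
- by rewrite -[X in coprime _ X](prednK (prime_gt0 r_prime)) coprimenS.
have nuz : nu z = z.
  by rewrite nu1 ?expr1 // exprM (prim_expr_order z_prim) expr1n.
have nuw : nu w = w^-1.
  rewrite nu2 ?(prim_expr_order w_prim) //.
  apply: (mulIf (primitive_root_neq0 w_prim)).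
  rewrite mulVf ?(primitive_root_neq0 w_prim) // -exprSr prednK ?prime_gt0 //.
  exact: prim_expr_order.
exists nu; split.
- apply: Qlayer_sqrt_fixed_roots => x x1; rewrite nu1 //.
    by rewrite addn2 in x1; rewrite expnSr -mulnA exprM x1 expr1n.
  by rewrite mulnC exprM x1 expr1n.
- rewrite rmorphM rmorphXn /= nuz half_product_autV // -signr_odd r2_odd.
  by rewrite mulN1r mulrN.
- by rewrite rmorphD fmorphV /= nuz.
Qed.

(** The automorphism maps [z] to [- z] and fixes the roots of unity of order
    dividing [p * r]; it also fixes [z ^ 2], hence all the roots of unity of
    order dividing [2 ^ n.+2]. *)
Lemma negate_double_cos : exists nu : {rmorphism algC -> algC},
  [/\ {in K, nu =1 id}, nu sqrt_r = sqrt_r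
    & nu (double_cos z) = - double_cos z].
Proof.
have [|||nu [nu1 nu2]] :=
    @cyclotomic_aut_exists (2 ^ n.+3) (p * r) (2 ^ n.+2).+1 1.
- by rewrite coprimeMr !coprimeXl // coprime2n.
- by rewrite coprimeXr // coprimen2 /= oddX.
- by rewrite coprime1n.
have nuz : nu z = - z.
  by rewrite nu1 ?(prim_expr_order z_prim) // exprS z_expr2 mulrN1.
exists nu; split.
- apply: Qlayer_sqrt_fixed_roots => x x1; last first.
    by rewrite nu2 // exprM x1 expr1n.
  rewrite addn2 in x1.
  by rewrite nu1; [rewrite exprS x1 mulr1 | rewrite expnSr exprM x1 expr1n].
- rewrite rmorphM rmorphXn /= nuz half_product_aut; last first.
    by rewrite nu2 // mulnC exprM (prim_expr_order w_prim) expr1n.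
  by rewrite exprNn -signr_odd oddX mul1r.
- by rewrite rmorphD fmorphV /= nuz invrN opprD.
Qed.

Hypothesis S2r : {subset pred2 2%N r <= S}.
Let M := max_abelian_unramified_outside K S.

Lemma sqrt_r_max_abelian : sqrt_r \in M.
Proof.
have [D rankL] := quad_Qlayer_sqrt_rank n p sqrt_r.
have [nu [nuK nu_r _]] := negate_sqrt_r.
apply: (quad_max_abelian sqrt_r_Aint _ sqrt_r_neq0 nuK nu_r rankL).
- by rewrite sqrt_r_sqr rpred_nat.
- by apply: S2r; rewrite inE.
- move=> P PS c cE; have -> : c = r%:R.
    by apply: val_inj; rewrite cE sqrt_r_sqr rmorph_nat.
  by apply: PS; apply: S2r; rewrite !inE eqxx orbT.
move=> tau; apply: sqr_real_nneg; rewrite -rmorphXn.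
have -> : FieldOf (quad_field_gen K sqrt_r) ^+ 2 = r%:R.
  by apply: val_inj; rewrite rmorphXn rmorph_nat; apply: sqrt_r_sqr.
by rewrite rmorph_nat ler0n.
Qed.

Lemma double_cos_max_abelian : double_cos z \in M.
Proof.
have [D rankL] := quad_Qlayer_sqrt_rank n p (double_cos z).
have [nu [nuK _ nu_c]] := negate_double_cos.
apply: (quad_max_abelian double_cos_Aint double_cos_sqr_Qlayer_sqrt
          double_cos_neq0 nuK nu_c rankL).
- by apply: S2r; rewrite inE.
- have [b bA zb] := double_cos_dvd2 z_prim.
  have b2K : b ^+ 2 \in integral_in K.
    apply/andP; split; last exact: rpredX.
    rewrite -[b](mulKf double_cos_neq0) zb exprMn exprVn.
    rewrite rpredM ?rpredV ?double_cos_sqr_Qlayer_sqrt //.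
    by rewrite rpredX // rpred_nat.
  move=> P PS c cE; have : 2%:R \notin P by apply: PS; apply: S2r; rewrite inE.
  apply: contra => cP; have : 2%:R * 2%:R \in P; last first.
    by rewrite prime_idealrM orbb.
  have -> : 2%:R * 2%:R = RingInt b2K * c.
    apply: val_inj; rewrite !rmorphM !rmorph_nat /= cE.
    by rewrite -exprMn [b * _]mulrC zb expr2.
  by rewrite idealMr.
(* Iterating [x ^ 2 - 2], which doubles the angle, maps [double_cos z] to twice
   the cosine of a right angle; so every conjugate of [double_cos z] has an
   iterate equal to [0], and is real. *)
move=> tau; set x := FieldOf _.
suff /iter_sqr_sub2_real/andP[] :
  iter n.+1 (fun y => y ^+ 2 - 2) (tau x) = 0 by [].
have -> : iter n.+1 (fun y => y ^+ 2 - 2) (tau x) =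
          tau (iter n.+1 (fun y => y ^+ 2 - 2) x).
  elim: n.+1 => // j IHj; rewrite !iterS IHj.
  by rewrite rmorphB rmorphXn rmorph_nat.
suff -> : iter n.+1 (fun y => y ^+ 2 - 2) x = 0 by rewrite rmorph0.
apply: val_inj; rewrite rmorph0.
have -> : val (iter n.+1 (fun y => y ^+ 2 - 2) x) =
          iter n.+1 (fun y => y ^+ 2 - 2) (double_cos z).
  elim: n.+1 => // j IHj; rewrite !iterS -IHj.
  by rewrite rmorphB rmorphXn rmorph_nat.
rewrite double_cos_iter ?(primitive_root_neq0 z_prim) // /double_cos.
set i := z ^+ _; have i2 : i ^+ 2 = -1 by rewrite -exprM -expnSr.
have i0 : i != 0 by rewrite -sqrf_eq0 i2 oppr_eq0 oner_eq0.
by apply: (mulIf i0); rewrite mulrDl mulVf // -expr2 i2 addNr mul0r.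
Qed.

End TwoExtensions.

Theorem corollary1p5 (p r n : nat)
    (p_prime : prime p) (r_prime : prime r)
    (p_mod16 : (p = 9 %[mod 16])%N) (r_mod4 : (r = 3 %[mod 4])%N)
    (p_r : legendre p r = -1)
    (two_p_4 : ~ exists x : nat, (x ^ 4 = 2 %[mod p])%N) :
  let K := Qlayer_sqrt n p in
  two_rank_ge (autC K (max_abelian_unramified_outside K (pred2 2%N r))) 2.
Proof.
move=> K.
have p_mod4 : (p = 1 %[mod 4])%N by lia.
have [z z_prim] := C_prim_root_exists (expn_gt0 2 n.+3).
have [w w_prim] := C_prim_root_exists (prime_gt0 r_prime).
have rM := sqrt_r_max_abelian p_prime r_prime p_mod4 r_mod4 z_prim w_prim
  (S := pred2 2%N r) (fun _ => id).
have cM := double_cos_max_abelian p_mod4 r_mod4 z_prim w_prim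
  (S := pred2 2%N r) (fun _ => id).
have [nu [nuK nu_r nu_c]] :=
  negate_sqrt_r p_prime r_prime p_mod4 r_mod4 z_prim w_prim.
have [mu [muK mu_r mu_c]] :=
  negate_double_cos p_mod4 r_mod4 z_prim w_prim.
have [s sE] := max_abelian_restrict (pred2 2%N r) nuK.
have [t tE] := max_abelian_restrict (pred2 2%N r) muK.
apply: (@two_rank_ge2_signs _ _ _ _ s t rM cM); rewrite ?sE ?tE //.
- exact: (sqrt_r_neq0 r_prime r_mod4 z_prim w_prim).
- exact: double_cos_neq0 z_prim.
- by rewrite sqrt_r_sqr // rpred_nat.
- exact: double_cos_sqr_Qlayer_sqrt z_prim.
Qed.
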